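(* Let $\mathcal{C}$ be a quasicategory with markings $W_0\subseteq W$, where $W$ is weakly closed under composition, and let $F\colon(\mathcal{C},W)\to(\mathcal{C},W_0)$ be a marked endofunctor (i.e. an endomorphism of $\mathcal{C}$ sending $W$ into $W_0$). (1) If $(\mathcal{C},W_0)$ has the right lifting property against $\{\mathrm{LJ}^n_k\hookrightarrow\mathrm{L}^n_k \mid n\ge2,\ 0<k\le n\}$ and there exists a marked homotopy $\alpha\colon(\mathcal{C},W)\times(\Delta^1)^\sharp\to(\mathcal{C},W)$ from $\mathrm{id}$ to $F$, then $(\mathcal{C},W)$ satisfies CLF. (2) If $(\mathcal{C},W_0)$ has the right lifting property against $\{\mathrm{RJ}^n_k\hookrightarrow\mathrm{R}^n_k\mid n\ge2,\ 0\le k<n\}$ and there exists a marked homotopy $\alpha\colon(\mathcal{C},W)\times(\Delta^1)^\sharp\to(\mathcal{C},W)$ from $F$ to $\mathrm{id}$, then $(\mathcal{C},W)$ satisfies CRF.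
   Context: A marked simplicial set is a pair $(X,W)$ where $X$ is a simplicial set and $W \subseteq X_1$ contains all degenerate $1$-simplices; marked maps preserve marked $1$-simplices. $(\Delta^1)^\sharp$ is $\Delta^1$ with all $1$-simplices marked; products of marked simplicial sets are marked at pairs of marked $1$-simplices. A marked homotopy from $f$ to $g$ is a marked map $\alpha\colon (X,W)\times(\Delta^1)^\sharp\to(X',W')$ with $\alpha|_{X\times\{0\}}=f$, $\alpha|_{X\times\{1\}}=g$. Posets are regarded as simplicial sets via the nerve; $[n]=\{0<\dots<n\}$. For $n\ge 0$, $0\le k\le n$, $\mathrm{L}^n_k$ is the nerve of the poset of subsets $A\subseteq[n]$ with $k\in A$, ordered by inclusion, where $A_0\subseteq A_1$ is marked iff $\max A_0=\max A_1$; $\mathrm{LJ}^n_k\subseteq \mathrm{L}^n_k$ is the maximal simplicial subset not containing the vertex $[n]$. $\mathrm{R}^n_k$ is the nerve of the opposite poset (arrows $A_0\to A_1$ when $A_0\supseteq A_1$), where $A_0\supseteq A_1$ is marked iff $\min A_0=\min A_1$; $\mathrm{RJ}^n_k\subseteq\mathrm{R}^n_k$ is the maximal simplicial subset omitting the vertex $[n]$. $W$ is weakly closed under composition if every map $\Lambda^2_1\to X$ with both edges marked extends to a $2$-simplex all of whose edges are marked. A marked quasicategory $(\mathcal{C},W)$ satisfies CLF if $W$ is weakly closed under composition and it has the right lifting property against all $\mathrm{LJ}^n_k\hookrightarrow\mathrm{L}^n_k$ ($n\ge2$, $0<k\le n$); it satisfies CRF if $W$ is weakly closed under composition and it has the right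 lifting property against all $\mathrm{RJ}^n_k\hookrightarrow\mathrm{R}^n_k$ ($n\ge2$, $0\le k<n$). *)

(* Defs.v *)
From HB Require Import structures.
From mathcomp Require Import all_boot.

Set Implicit Arguments.
Unset Strict Implicit.
Unset Printing Implicit Defensive.

Definition monob m n (f : {ffun 'I_m.+1 -> 'I_n.+1}) : bool :=
  [forall i : 'I_m.+1, [forall j : 'I_m.+1, (i <= j) ==> (f i <= f j)]].

Lemma monobP m n (f : {ffun 'I_m.+1 -> 'I_n.+1}) :
  reflect (forall i j : 'I_m.+1, i <= j -> f i <= f j) (monob f).
Proof.
apply: (iffP forallP) => [H i j ij | H i].
  exact: (implyP (forallP (H i) j) ij).
by apply/forallP => j; apply/implyP; exact: H.
Qed.

Definition monmap m n := {f : {ffun 'I_m.+1 -> 'I_n.+1} | monob f}.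

Lemma mid_mono n : monob [ffun i : 'I_n.+1 => i].
Proof. by apply/monobP => i j; rewrite !ffunE. Qed.
Definition mid n : monmap n n := exist (@monob n n) _ (mid_mono n).

Lemma mcomp_mono m n p (g : monmap n p) (f : monmap m n) :
  monob [ffun i => sval g (sval f i)].
Proof.
apply/monobP => i j ij; rewrite !ffunE.
apply: (monobP _ (svalP g)); exact: (monobP _ (svalP f)).
Qed.
Definition mcomp m n p (g : monmap n p) (f : monmap m n) : monmap m p :=
  exist (@monob m p) _ (mcomp_mono g f).

Lemma sig_bool_eq (T : Type) (p : T -> bool) (a b : {x | p x}) :
  sval a = sval b -> a = b.
Proof. case: a b => [a pa] [b pb] /= eab; subst b; congr exist; exact: bool_irrelevance. Qed.

Record sSet := SSet {
  sx :> nat -> Type;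
  sact : forall m n, monmap m n -> sx n -> sx m;
  sact_id : forall n (x : sx n), sact (mid n) x = x;
  sact_comp : forall m n p (g : monmap n p) (f : monmap m n) (x : sx p),
      sact (mcomp g f) x = sact f (sact g x) }.
Arguments sact {s m n}.

Record sMap (X Y : sSet) := SMap {
  smap :> forall n, X n -> Y n;
  smap_nat : forall m n (f : monmap m n) (x : X n),
      @smap m (sact f x) = sact f (@smap n x) }.

Arguments smap {X Y} s n _.

Section Nerve.
Variables (P : Type) (le : P -> P -> bool).

Definition chainb n (s : {ffun 'I_n.+1 -> P}) : bool :=
  [forall i : 'I_n.+1, [forall j : 'I_n.+1, (i <= j) ==> le (s i) (s j)]].

Definition nerve_x n := {s : {ffun 'I_n.+1 -> P} | chainb s}.

Lemma chain_act m n (f : monmap m n) (s : nerve_x n) :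
  chainb [ffun i => sval s (sval f i)].
Proof.
apply/forallP => i; apply/forallP => j; apply/implyP => ij; rewrite !ffunE.
have fij := monobP _ (svalP f) i j ij.
exact: (implyP (forallP (forallP (svalP s) (sval f i)) (sval f j)) fij).
Qed.

Definition nerve_act m n (f : monmap m n) (s : nerve_x n) : nerve_x m :=
  exist (@chainb m) _ (chain_act f s).

Lemma nerve_act_id n (s : nerve_x n) : nerve_act (mid n) s = s.
Proof. by apply: sig_bool_eq; apply/ffunP => i; rewrite /= !ffunE. Qed.

Lemma nerve_act_comp m n p (g : monmap n p) (f : monmap m n) (s : nerve_x p) :
  nerve_act (mcomp g f) s = nerve_act f (nerve_act g s).
Proof. by apply: sig_bool_eq; apply/ffunP => i; rewrite /= !ffunE. Qed.

Definition nerve : sSet := SSet nerve_act_id nerve_act_comp.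
End Nerve.

Section Sub.
Variables (X : sSet) (Pr : forall n, X n -> bool)
  (HP : forall m n (f : monmap m n) (x : X n), @Pr n x -> @Pr m (sact f x)).

Definition sub_x n := {x : X n | @Pr n x}.
Definition sub_act m n (f : monmap m n) (x : sub_x n) : sub_x m :=
  exist (@Pr m) _ (HP f (svalP x)).
Lemma sub_act_id n (x : sub_x n) : sub_act (mid n) x = x.
Proof. by apply: sig_bool_eq; rewrite /= sact_id. Qed.
Lemma sub_act_comp m n p (g : monmap n p) (f : monmap m n) (x : sub_x p) :
  sub_act (mcomp g f) x = sub_act f (sub_act g x).
Proof. by apply: sig_bool_eq; rewrite /= sact_comp. Qed.
Definition subsSet : sSet := SSet sub_act_id sub_act_comp.
Definition sub_incl : sMap subsSet X := @SMap subsSet X (fun n x => sval x) (fun _ _ _ _ => erefl).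
End Sub.

Lemma s0_mono : monob [ffun _ : 'I_2 => (ord0 : 'I_1)].
Proof. by apply/monobP => i j; rewrite !ffunE. Qed.
(* the unique map [1] -> [0]; sact s0map x is the degenerate edge at x *)
Definition s0map : monmap 1 0 := exist (@monob 1 0) _ s0_mono.

Definition degen_marked (X : sSet) (W : X 1 -> Prop) :=
  forall x : X 0, W (sact s0map x).

Record msSet := MSSet {
  mcar :> sSet;
  marked : mcar 1 -> Prop;
  marked_degen : degen_marked marked }.

Record mMap (A B : msSet) := MMap {
  mmap :> sMap A B;
  mmap_marked : forall e : A 1, marked e -> marked (@mmap 1 e) }.

Arguments mmap {A B} m.

Section MSub.
Variables (X : msSet) (Pr : forall n, X n -> bool)
  (HP : forall m n (f : monmap m n) (x : X n), @Pr n x -> @Pr m (sact f x)).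
Definition msub : msSet :=
  @MSSet (subsSet HP) (fun e => marked (sval e)) (fun x => marked_degen (sval x)).
Definition msub_incl : mMap msub X := @MMap msub X (sub_incl HP) (fun e h => h).
End MSub.

Section Prod.
Variables A B : msSet.
Definition prod_act m n (f : monmap m n) (p : A n * B n) : A m * B m :=
  (sact f p.1, sact f p.2).
Lemma prod_act_id n (p : A n * B n) : prod_act (mid n) p = p.
Proof. by case: p => a b; rewrite /prod_act /= !sact_id. Qed.
Lemma prod_act_comp m n p (g : monmap n p) (f : monmap m n) (x : A p * B p) :
  prod_act (mcomp g f) x = prod_act f (prod_act g x).
Proof. by case: x => a b; rewrite /prod_act /= !sact_comp. Qed.
Definition prod_sSet : sSet := SSet prod_act_id prod_act_comp.
Definition mprod : msSet :=
  @MSSet prod_sSet (fun e => marked e.1 /\ marked e.2)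
    (fun x => conj (marked_degen x.1) (marked_degen x.2)).
End Prod.

Definition Delta n : sSet := nerve (fun i j : 'I_n.+1 => i <= j).

Definition Delta1s : msSet := @MSSet (Delta 1) (fun _ => True) (fun _ => I).

Lemma cst_chain n (v : 'I_2) : chainb (fun i j : 'I_2 => i <= j) [ffun _ : 'I_n.+1 => v].
Proof. by apply/forallP => i; apply/forallP => j; rewrite !ffunE leqnn implybT. Qed.
Definition cst n (v : 'I_2) : Delta 1 n := exist (chainb (fun i j : 'I_2 => i <= j) (n:=n)) _ (cst_chain n v).

Definition hornP n (k : 'I_n.+1) m (s : Delta n m) : bool :=
  [exists i : 'I_n.+1, (i != k) && [forall j, sval s j != i]].
Lemma hornP_act n k m p (f : monmap m p) (s : Delta n p) :
  hornP k s -> hornP k (sact f s).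
Proof.
case/existsP => i /andP [ik /forallP Hi]; apply/existsP; exists i.
by rewrite ik /=; apply/forallP => j; rewrite /= ffunE Hi.
Qed.
Definition horn n (k : 'I_n.+1) : sSet := subsSet (@hornP_act n k).
Definition horn_incl n (k : 'I_n.+1) : sMap (horn k) (Delta n) := sub_incl (@hornP_act n k).

Definition RLP (A B : sSet) (i : sMap A B) (X : sSet) :=
  forall h : sMap A X, exists g : sMap B X, forall n (a : A n), g n (i n a) = h n a.

Definition mRLP (A B : msSet) (i : mMap A B) (X : msSet) :=
  forall h : mMap A X, exists g : mMap B X, forall n (a : A n), g n (i n a) = h n a.

Definition quasicategory (X : sSet) :=
  forall n (k : 'I_n.+1), 0 < k < n -> RLP (horn_incl k) X.

Definition one3 : 'I_3 := @Ordinal 3 1 isT.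

Definition weakly_closed (X : sSet) (W : X 1 -> Prop) :=
  forall h : sMap (horn one3) X, (forall e, W (h 1 e)) ->
  exists s : sMap (Delta 2) X,
    (forall n (a : horn one3 n), s n (horn_incl one3 n a) = h n a) /\
    (forall e, W (s 1 e)).

Definition Lel n (k : 'I_n.+1) := {A : {set 'I_n.+1} | k \in A}.
Definition maxs n (A : {set 'I_n.+1}) : nat := \max_(i in A) (i : nat).
Definition mins n (A : {set 'I_n.+1}) : nat := \big[minn/n]_(i in A) (i : nat).

Definition Lle n (k : 'I_n.+1) (A B : Lel k) : bool := sval A \subset sval B.
Definition Rle n (k : 'I_n.+1) (A B : Lel k) : bool := sval B \subset sval A.

Definition Lnerve n (k : 'I_n.+1) : sSet := nerve (@Lle n k).
Definition Rnerve n (k : 'I_n.+1) : sSet := nerve (@Rle n k).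

Definition Lmarked n (k : 'I_n.+1) (e : Lnerve k 1) : Prop :=
  maxs (sval (sval e ord0)) = maxs (sval (sval e ord_max)).
Definition Rmarked n (k : 'I_n.+1) (e : Rnerve k 1) : Prop :=
  mins (sval (sval e ord0)) = mins (sval (sval e ord_max)).

Lemma Lmarked_degen n k : degen_marked (@Lmarked n k).
Proof. by move=> x; rewrite /Lmarked /= !ffunE. Qed.
Lemma Rmarked_degen n k : degen_marked (@Rmarked n k).
Proof. by move=> x; rewrite /Rmarked /= !ffunE. Qed.

Definition L n (k : 'I_n.+1) : msSet := MSSet (@Lmarked_degen n k).
Definition R n (k : 'I_n.+1) : msSet := MSSet (@Rmarked_degen n k).

(* maximal simplicial subsets omitting the vertex [n] *)
Definition omitTopP n (k : 'I_n.+1) m (s : {ffun 'I_m.+1 -> Lel k}) : bool :=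
  [forall j : 'I_m.+1, sval (s j) != [set: 'I_n.+1]].
Definition LJP n (k : 'I_n.+1) p (s : L k p) : bool := omitTopP (sval s).
Definition RJP n (k : 'I_n.+1) p (s : R k p) : bool := omitTopP (sval s).
Lemma omitTopL_act n (k : 'I_n.+1) m p (f : monmap m p) (s : L k p) :
  LJP s -> LJP (sact f s).
Proof. by move/forallP => H; apply/forallP => j; rewrite /= ffunE H. Qed.
Lemma omitTopR_act n (k : 'I_n.+1) m p (f : monmap m p) (s : R k p) :
  RJP s -> RJP (sact f s).
Proof. by move/forallP => H; apply/forallP => j; rewrite /= ffunE H. Qed.

Definition LJ n (k : 'I_n.+1) : msSet := msub (@omitTopL_act n k).
Definition RJ n (k : 'I_n.+1) : msSet := msub (@omitTopR_act n k).
Definition LJ_incl n (k : 'I_n.+1) : mMap (LJ k) (L k) := msub_incl (@omitTopL_act n k).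
Definition RJ_incl n (k : 'I_n.+1) : mMap (RJ k) (R k) := msub_incl (@omitTopR_act n k).

Definition CLF (X : msSet) :=
  weakly_closed (@marked X) /\
  forall n (k : 'I_n.+1), 2 <= n -> 0 < k -> mRLP (LJ_incl k) X.
Definition CRF (X : msSet) :=
  weakly_closed (@marked X) /\
  forall n (k : 'I_n.+1), 2 <= n -> k < n -> mRLP (RJ_incl k) X.

Definition mhomotopy (A B : msSet) (f g : forall n, A n -> B n)
  (alpha : mMap (mprod A Delta1s) B) :=
  forall n (x : A n),
    alpha n ((x, cst n ord0) : prod_sSet A Delta1s n) = f n x /\
    alpha n ((x, cst n ord_max) : prod_sSet A Delta1s n) = g n x.

(* Main.v *)
Require Import Defs.
From mathcomp Require Import all_boot.

Set Implicit Arguments.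
Unset Strict Implicit.
Unset Printing Implicit Defensive.

(** The poset underlying L is that of LJ with a greatest element t = [n]
    added, so a lift of h is a cone under h.  A lift G of F h to (C, W0) and the
    homotopy alpha from h to F h define a map on the part of the nerve of the
    cylinder L x {false < true}, minus (t, false), formed by the chains that
    avoid (t, true) or lie in the upper level.  It extends to the whole nerve by
    filling inner horns: each remaining chain A is paired with the chain obtained
    by inserting or deleting (p, true), where (p, false) is the largest vertex of
    A in the lower level.  The lift is the restriction to the lower level
    together with (t, true).  The only new edges that have to be marked are
    the composites (p, false) -> (p, true) -> (t, true) of marked edges; those
    2-simplices are filled by weak closure under composition.  The R case is the
    same argument for the reversed order. *)

(** * Chains in a finite poset and partial simplicial maps out of its nerve *)

Section Complexes.
Variables (Q : finType) (le : rel Q).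
Hypotheses (le_refl : reflexive le) (le_anti : antisymmetric le)
  (le_trans : transitive le).

Local Notation N := (nerve le).

Definition im n (s : N n) : {set Q} := [set sval s i | i in 'I_n.+1].

Definition chain (A : {set Q}) : bool :=
  [forall x in A, forall y in A, le x y || le y x].

Lemma chainP (A : {set Q}) :
  reflect {in A &, forall x y, le x y || le y x} (chain A).
Proof.
apply: (iffP forall_inP) => [H x y xA yA | H x xA].
  exact: (forall_inP (H x xA) y yA).
by apply/forall_inP => y yA; apply: H.
Qed.

Lemma nerve_le n (s : N n) (i j : 'I_n.+1) : i <= j -> le (sval s i) (sval s j).
Proof. by move=> ij; exact: (implyP (forallP (forallP (svalP s) i) j) ij). Qed.

Lemma mem_im n (s : N n) i : sval s i \in im s.
Proof. exact: imset_f. Qed.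

Lemma im_chain n (s : N n) : chain (im s).
Proof.
apply/chainP => _ _ /imsetP [i _ ->] /imsetP [j _ ->].
by case/orP: (leq_total i j) => /nerve_le->; rewrite ?orbT.
Qed.

Lemma im_act m n (f : monmap m n) (s : N n) : im (sact f s) \subset im s.
Proof. by apply/subsetP => _ /imsetP [i _ ->]; rewrite /= ffunE mem_im. Qed.

Lemma chainS (A B : {set Q}) : A \subset B -> chain B -> chain A.
Proof. by move=> /subsetP AB /chainP cB; apply/chainP => x y /AB ? /AB ?; apply: cB. Qed.

Lemma chain_enum (A : {set Q}) d : chain A -> #|A| = d.+1 ->
  exists e : 'I_d.+1 -> Q, (forall i j : 'I_d.+1, le (e i) (e j) = (i <= j)) /\
    (forall x, x \in A <-> exists i, x = e i).
Proof.
move=> /chainP cA cardA.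
have [x0 x0A] : exists x, x \in A by apply/card_gt0P; rewrite cardA.
pose s := sort le (enum A).
have ss : size s = d.+1 by rewrite size_sort -cardE.
have sA x : (x \in s) = (x \in A) by rewrite mem_sort mem_enum.
have us : uniq s by rewrite sort_uniq enum_uniq.
have srt : sorted le s.
  apply: (@sort_sorted_in _ (mem A)); last by apply/allP => x; rewrite mem_enum.
  by move=> x y; apply: cA.
exists (fun i => nth x0 s i); split=> [i j | x].
  have mono (a b : 'I_d.+1) : a <= b -> le (nth x0 s a) (nth x0 s b).
    by move=> ab; apply: (sorted_leq_nth le_trans le_refl _ srt) => //;
      rewrite inE ss.
  apply/idP/idP => [lij|]; last exact: mono.
  rewrite leqNgt; apply/negP => ji.
  have := le_anti (introT andP (conj lij (mono _ _ (ltnW ji)))).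
  move/eqP; rewrite nth_uniq ?ss // => /eqP eij.
  by rewrite eij ltnn in ji.
rewrite -sA; split=> [xs | [i ->]]; last by rewrite mem_nth ?ss.
have xi : index x s < d.+1 by rewrite -ss index_mem.
by exists (Ordinal xi); rewrite /= nth_index.
Qed.

(* The rank of x is the number of non-minimal elements of the enumerated chain
   lying below x; being monotone on all of Q, it retracts the nerve of Q onto
   the simplex spanned by the chain. *)
Lemma chain_rank d (e : 'I_d.+1 -> Q) :
  (forall i j : 'I_d.+1, le (e i) (e j) = (i <= j)) ->
  exists r : Q -> 'I_d.+1, {homo r : x y / le x y >-> x <= y} /\ cancel e r.
Proof.
move=> emono.
pose B x := [set i : 'I_d | le (e (lift ord0 i)) x].
have Bd x : #|B x| < d.+1 by rewrite ltnS -[X in _ <= X]card_ord max_card.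
exists (fun x => Ordinal (Bd x)); split=> [x y xy | j] /=.
  apply/subset_leq_card/subsetP => i; rewrite !inE => /le_trans; exact.
apply: val_inj => /=.
rewrite -sum1_card (eq_bigl (fun i : 'I_d => (i < j)%N)); last first.
  by move=> i; rewrite inE emono lift0.
by rewrite -(@big_ord_widen _ _ _ j d (fun=> 1)) ?sum1_card ?card_ord // -ltnS.
Qed.

Variables (C : sSet) (W : C 1 -> Prop).
Hypotheses (qC : quasicategory C) (wW : weakly_closed W).

(* A simplicial map defined on the subcomplex of chains in S is represented by
   a total function on simplices, whose values outside S are irrelevant. *)
Definition nat_on (S : pred {set Q}) (g : forall n, N n -> C n) : Prop :=
  forall m n (f : monmap m n) (s : N n),
    S (im s) -> g m (sact f s) = sact f (g n s).

Variable M : rel Q.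
Hypothesis M_refl : reflexive M.

(** An edge of a nerve is determined by its end points, so its marking is encoded as a relation [M]
    on vertices. *)
Definition marks (S : pred {set Q}) (g : forall n, N n -> C n) : Prop :=
  forall e : N 1, S (im e) -> M (sval e ord0) (sval e ord_max) -> W (g 1 e).

Definition down_closed (S : pred {set Q}) : Prop :=
  forall A B : {set Q}, A \subset B -> S B -> S A.

(** * Filling a single inner horn *)

Section Fill.
Variables (S : pred {set Q}) (sigma : {set Q}) (v a b : Q).
Hypotheses (Sd : down_closed S) (sch : chain sigma).
Hypotheses (vs : v \in sigma) (as_ : a \in sigma) (bs : b \in sigma)
  (av : a != v) (bv : b != v) (lav : le a v) (lvb : le v b).
Hypotheses (Sface : forall u, u \in sigma -> u != v -> S (sigma :\ u))
  (Sv : ~~ S (sigma :\ v)).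
Hypothesis HM : forall x y, le x y -> x \in sigma -> y \in sigma ->
  ~~ S [set x; y] -> M x y -> M x v /\ M v y.

(** A subset of [sigma] omitting some [u] other than [v] lies in a face that belongs to [S]. Hence
    only [sigma] and its face opposite [v] are missing: [S] meets [sigma] in the horn at [v]. *)
Lemma missing_supset (A : {set Q}) : A \subset sigma -> ~~ S A -> sigma :\ v \subset A.
Proof.
move=> As nSA; apply/subsetP => u; rewrite !inE => /andP [uv us].
apply: contraNT nSA => uA; apply: Sd (Sface us uv).
by rewrite subsetD1 As.
Qed.

Lemma neq_ab : a != b.
Proof. by apply: contra_neqN av => /eqP E; apply: le_anti; rewrite lav E lvb. Qed.

(** A missing edge contains [sigma :\ v], hence both [a] and [b], so [sigma] is a triangle;
    antisymmetry orders the end points. *)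
Lemma new_edge x y : le x y -> x \in sigma -> y \in sigma ->
  ~~ S [set x; y] -> [/\ x = a, y = b & sigma = [set a; v; b]].
Proof.
move=> lxy xs ys nS.
have ab := neq_ab.
have sub : [set x; y] \subset sigma by apply/subsetP => z /set2P [] ->.
have /subsetP sup := missing_supset sub nS.
have aI : a \in [set x; y] by apply: sup; rewrite !inE av.
have bI : b \in [set x; y] by apply: sup; rewrite !inE bv.
have [xa yb] : x = a /\ y = b.
  case/set2P: aI => E1; case/set2P: bI => E2.
  - by rewrite E1 E2 eqxx in ab.
  - by [].
  - case/eqP: ab; apply: le_anti; rewrite (le_trans lav lvb) /= E1 E2.
    by [].
  - by rewrite E1 E2 eqxx in ab.
split=> //; apply/setP => z; rewrite !inE -orbA.
apply/idP/idP => [zs | /or3P [] /eqP -> //].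
have [->|zv] := eqVneq z v; first by rewrite orbT.
have := sup z; rewrite !inE zv zs xa yb => /(_ isT) /orP [] ->; by rewrite ?orbT.
Qed.

(** Enumerating [sigma] as a standard simplex puts [v] at an inner position, so the quasicategory
    supplies a filler. When the missing face is a marked edge, the filler comes instead from weak
    closure under composition. *)
Lemma fill_horn (g : forall n, N n -> C n) : nat_on S g -> marks S g ->
  exists g' : forall n, N n -> C n,
    [/\ nat_on (fun A => S A || (A \subset sigma)) g',
        marks (fun A => S A || (A \subset sigma)) g' &
        forall n (s : N n), S (im s) -> g' n s = g n s].
Proof.
move=> gnat gM.
have [d cs] : exists d, #|sigma| = d.+1.
  by exists #|sigma|.-1; rewrite prednK //; apply/card_gt0P; exists v.
have [e [emono eP]] := chain_enum sch cs.
have [r [rmono eK]] := chain_rank emono.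
have es i : e i \in sigma by apply/eP; exists i.
have rK x : x \in sigma -> e (r x) = x by case/eP => i ->; rewrite eK.
pose k := r v.
have k_int : 0 < k < d.
  have lt x y : le x y -> x != y -> x \in sigma -> y \in sigma -> r x < r y.
    move=> lxy xy xs ys; rewrite ltn_neqAle rmono // andbT.
    by apply: contra_neqN xy => /eqP /val_inj E; rewrite -(rK x) // E rK.
  have ltab : r a < k < r b.
    by rewrite !lt // eq_sym.
  case/andP: ltab => ak kb; apply/andP; split; first exact: leq_ltn_trans ak.
  by apply: leq_trans kb _; rewrite -ltnS.
have Ech m (c : Delta d m) : chainb le [ffun i => e (sval c i)].
  apply/forallP => i; apply/forallP => j; apply/implyP => ij; rewrite !ffunE emono.
  exact: (implyP (forallP (forallP (svalP c) i) j) ij).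
pose E m (c : Delta d m) : N m := exist (@chainb _ le m) _ (Ech m c).
have Dch m (s : N m) : chainb (fun i j : 'I_d.+1 => i <= j) [ffun i => r (sval s i)].
  apply/forallP => i; apply/forallP => j; apply/implyP => ij; rewrite !ffunE.
  by apply: rmono; apply: nerve_le.
pose D m (s : N m) : Delta d m := exist (@chainb _ _ m) _ (Dch m s).
have Dnat m n (f : monmap m n) (s : N n) : D m (sact f s) = sact f (D n s).
  by apply: sig_bool_eq; apply/ffunP => i; rewrite /= !ffunE.
have Enat m n (f : monmap m n) (c : Delta d n) : E m (sact f c) = sact f (E n c).
  by apply: sig_bool_eq; apply/ffunP => i; rewrite /= !ffunE.
have DK m (s : N m) : im s \subset sigma -> E m (D m s) = s.
  move=> /subsetP sub; apply: sig_bool_eq; apply/ffunP => i; rewrite /= !ffunE.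
  by rewrite rK // sub ?mem_im.
have Eim m (c : Delta d m) : im (E m c) \subset sigma.
  by apply/subsetP => _ /imsetP [i _ ->]; rewrite /= ffunE.
have SE m (c : Delta d m) : hornP k c -> S (im (E m c)).
  case/existsP => i /andP [ik /forallP Hi].
  apply: Sd (Sface (es i) _); last first.
    by apply: contra_neqN ik => /eqP Ev; rewrite /k -Ev eK.
  rewrite subsetD1 Eim; apply/imsetP => -[j _]; rewrite /= ffunE.
  by move/(can_inj eK) => H; move: (Hi j); rewrite -H eqxx.
have Dhorn m (s : N m) : S (im s) -> im s \subset sigma -> hornP k (D m s).
  move=> Ss sub; apply: contraNT Sv => nh; apply: Sd Ss.
  apply/subsetP => x; rewrite !inE => /andP [xv xs].
  rewrite -[x]rK //.
  have rxk : r x != k by apply: contra_neqN xv => /eqP H; rewrite -(rK x) // H rK.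
  have : ~~ [forall j, sval (D m s) j != r x].
    by move: nh; rewrite negb_exists => /forallP /(_ (r x)); rewrite rxk.
  rewrite negb_forall => /existsP [j]; rewrite negbK /= ffunE => /eqP <-.
  by rewrite rK ?mem_im //; apply: (subsetP sub); apply: mem_im.
have hnat m n (f : monmap m n) (c : horn k n) :
  g m (E m (sval (sact f c))) = sact f (g n (E n (sval c))).
  by rewrite /= Enat gnat //; apply: SE; apply: (svalP c).
pose h : sMap (horn k) C := @SMap (horn k) C (fun n c => g n (E n (sval c))) hnat.
pose new := [exists x in sigma, exists y in sigma,
  [&& le x y, ~~ S [set x; y] & M x y]].
have [phi phih phiM] : exists2 phi : sMap (Delta d) C,
    (forall n (c : horn k n), phi n (horn_incl k n c) = h n c) &
    new -> forall c, W (phi 1 c).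
  case: (boolP new) => [/exists_inP [x xs /exists_inP [y ys /and3P [lxy nS Mxy]]] | _].
    have [Mxv Mvy] := HM lxy xs ys nS Mxy.
    have [xa yb sE] := new_edge lxy xs ys nS.
    have ab := neq_ab.
    have d2 : d = 2.
      have := cs; rewrite sE setUC cardsU1 !inE cards2 av.
      by rewrite (negbTE bv) (eq_sym b) (negbTE ab) => -[].
    (* An edge of this horn is degenerate, or joins [a] to [v] or [v] to [b]; all of these are
       marked. *)
    have hW c : W (h 1 c).
      apply: gM; first by apply: SE; apply: (svalP c).
      have := SE _ _ (svalP c).
      have := nerve_le (E 1 (sval c)) (leq0n _ : (ord0 : 'I_2) <= (ord_max : 'I_2)).
      have sub0 := subsetP (Eim _ (sval c)) _ (mem_im _ ord0).
      have sub1 := subsetP (Eim _ (sval c)) _ (mem_im _ ord_max).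
      have := mem_im (E 1 (sval c)) ord0; have := mem_im (E 1 (sval c)) ord_max.
      move: sub0 sub1; set p := sval (E 1 (sval c)) ord0; set q := sval (E 1 (sval c)) ord_max.
      rewrite sE !inE -!orbA xa yb in Mxv Mvy Mxy nS *.
      have anti z w : le z w -> z != w -> le w z -> False.
        by move=> zw zNw wz; case/eqP: zNw; apply: le_anti; rewrite zw wz.
      move=> /or3P [] /eqP -> /or3P [] /eqP -> // qI pI lpq Sim.
      - case/negP: nS; apply: Sd Sim; apply/subsetP => z /set2P [] -> //.
      - by case: (anti a v).
      - by case: (anti a b) => //; apply: le_trans lvb.
      - by case: (anti v b) => //; rewrite eq_sym.
    subst d; have k1 : k = one3 by apply: val_inj; case: (k : 'I_3) k_int => -[|[|[]]].
    move: h hW; rewrite k1 => h hW.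
    by have [phi [p1 p2]] := wW hW; exists phi.
  by have [phi p1] := qC k_int h; exists phi.
exists (fun n s => if ~~ S (im s) && (im s \subset sigma) then phi n (D n s) else g n s).
(* A face of a new simplex may fall back into [S], so naturality requires both definitions to agree
   there. *)
have old n (s : N n) : S (im s) -> im s \subset sigma -> phi n (D n s) = g n s.
  move=> Ss sub; have := phih n (exist _ (D n s) (Dhorn n s Ss sub)).
  by rewrite /= => ->; rewrite DK.
split=> [m n f s | c | n s ->] //.
  case: (boolP (S (im s))) => [Ss _ | nSs /= sub].
    by rewrite (Sd (im_act f s) Ss) /= gnat.
  have sub' := subset_trans (im_act f s) sub.
  rewrite sub sub' andbT -smap_nat -Dnat.
  by case: ifPn => // /negPn Ss; rewrite old.
case: (boolP (S (im c))) => [Sc _ | nSc /= sub Mc]; first exact: gM.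
rewrite sub; apply: phiM.
have imc : im c = [set sval c ord0; sval c ord_max].
  apply/setP => x; apply/imsetP/set2P => [[i _ ->]|[->|->]].
  - by case: i => -[|[|//]] i2; [left|right]; congr (sval c _); apply: val_inj.
  - by exists ord0.
  - by exists ord_max.
apply/exists_inP; exists (sval c ord0); first by apply: (subsetP sub); apply: mem_im.
apply/exists_inP; exists (sval c ord_max); first by apply: (subsetP sub); apply: mem_im.
by rewrite -imc nSc Mc nerve_le.
Qed.
End Fill.

(** * Iterated horn filling along a matching of the missing cells *)

Section Matching.
Variables (Full S0 : pred {set Q}) (v : {set Q} -> Q) (rank : {set Q} -> nat).
Hypotheses (Full_chain : forall A, Full A -> chain A) (Full_down : down_closed Full)
  (S0_down : down_closed S0).
Hypothesis rank_proper : forall A B : {set Q}, A \proper B -> rank A < rank B.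
Hypothesis v_full : forall A, Full A -> ~~ S0 A -> Full (v A |: A).
Hypothesis v_inner : forall A, Full A -> ~~ S0 A ->
  exists a b, [/\ a \in A, b \in A, a != v A, b != v A & le a (v A) && le (v A) b].
Hypothesis v_U : forall A, Full A -> ~~ S0 A -> v (v A |: A) = v A.
Hypothesis v_D : forall A, Full A -> ~~ S0 A ->
  v (A :\ v A) = v A /\ ~~ S0 (A :\ v A).
Hypothesis v_face : forall A u, Full A -> ~~ S0 A -> v A \notin A -> u \in A ->
  [\/ S0 (v A |: (A :\ u)), ~~ S0 (A :\ u) /\ v (A :\ u) = v A
    | rank (v A |: (A :\ u)) < rank A].
Hypothesis v_M : forall x y, le x y -> Full [set x; y] -> ~~ S0 [set x; y] ->
  M x y -> M x (v [set x; y]) /\ M (v [set x; y]) y.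

(* A missing cell A of minimal rank is the free face, opposite to the inner
   vertex v A, of the cell v A |: A all of whose other faces are present. *)
Lemma extend_matching (g : forall n, N n -> C n) : nat_on S0 g -> marks S0 g ->
  exists g' : forall n, N n -> C n,
    [/\ nat_on Full g', marks Full g' &
        forall n (s : N n), S0 (im s) -> g' n s = g n s].
Proof.
move=> gnat gM.
(* Induction on the number of missing cells, with [S] growing from [S0]. The fourth condition on
   [S], together with down-closure, says that matched cells enter in pairs. *)
suff ext c : forall (S : pred {set Q}) (g1 : forall n, N n -> C n),
    #|[set A | Full A && ~~ S A]| < c -> (forall A, S0 A -> S A) -> down_closed S ->
    (forall A, Full A -> ~~ S0 A -> S A -> S (v A |: A)) ->
    nat_on S g1 -> marks S g1 ->
    exists g' : forall n, N n -> C n, [/\ nat_on Full g', marks Full g' &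
        forall n (s : N n), S (im s) -> g' n s = g1 n s].
  apply: (ext _.+1 S0 g (leqnn _)) => // A fA /negP; by [].
elim: c => // c IH S g1 cardS S0S Sd Sv g1nat g1M.
case: (pickP [pred A | Full A && ~~ S A]) => [A0 A0P | none]; last first.
  have FS A : Full A -> S A.
    by move=> fA; move: (none A); rewrite /= fA => /negbFE.
  by exists g1; split=> [m n f s /FS | e /FS |] //; [apply: g1nat | apply: g1M].
case: (arg_minnP rank A0P) => A /= /andP [fA nSA] Amin.
have low B : Full B -> rank B < rank A -> S B.
  move=> fB; rewrite ltnNge; apply: contraNT => nSB; apply: Amin.
  by rewrite fB.
have nS0A : ~~ S0 A by apply: contra nSA; apply: S0S.
have FD u : Full (A :\ u) by apply: Full_down fA; apply: subD1set.
have lowD u : u \in A -> S (A :\ u).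
  by move=> uA; apply: low => //; apply/rank_proper/properD1.
(* Otherwise [A :\ v A] has smaller rank, hence lies in [S], and its partner [A] would lie in [S]
   too. *)
have vA : v A \notin A.
  apply: contra nSA => vA; have [E nS0] := v_D fA nS0A.
  by have := Sv _ (FD (v A)) nS0 (lowD _ vA); rewrite E setD1K.
have AU : (v A |: A) :\ v A = A by rewrite setU1K.
have [a [b [aA bA av bv /andP [lav lvb]]]] := v_inner fA nS0A.
have fU := v_full fA nS0A.
(* By [v_face], such a face is in [S0], or is the partner of a cell already present, or has smaller
   rank than [A]. *)
have Sface u : u \in v A |: A -> u != v A -> S ((v A |: A) :\ u).
  move=> uU uv; have uA : u \in A by move: uU; rewrite !inE (negbTE uv).
  have -> : (v A |: A) :\ u = v A |: (A :\ u).
    apply/setP => x; rewrite !inE; case: (eqVneq x (v A)) => [->|] //=.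
    by rewrite eq_sym uv.
  have [/S0S // | [nS0 E] | lt] := v_face fA nS0A vA uA.
    by rewrite -E; apply: Sv => //; apply: lowD.
  apply: low lt; apply: Full_down fU; apply: setUS; exact: subD1set.
have nSU : ~~ S ((v A |: A) :\ v A) by rewrite AU.
have new (B : {set Q}) : B \subset v A |: A -> ~~ S B -> v B = v A /\ v A |: B = v A |: A.
  move=> sub nSB; have := missing_supset Sd Sface sub nSB; rewrite AU => AB.
  have UE : v A |: B = v A |: A.
    apply/eqP; rewrite eqEsubset (setUS _ AB) andbT subUset sub1set setU11 /=.
    exact: sub.
  split=> //; case: (boolP (v A \in B)) => vB.
    by move: UE; rewrite (setUidPr _) ?sub1set // => ->; apply: v_U.
  by congr v; rewrite -AU -UE setU1K.
have HM x y : le x y -> x \in v A |: A -> y \in v A |: A -> ~~ S [set x; y] ->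
    M x y -> M x (v A) /\ M (v A) y.
  move=> lxy xU yU nSxy Mxy.
  have sub : [set x; y] \subset v A |: A by apply/subsetP => z /set2P [] ->.
  have [<- _] := new _ sub nSxy.
  apply: v_M => //; first exact: Full_down fU.
  by apply: contra nSxy; apply: S0S.
have UA u : u \in A -> u \in v A |: A by move=> uA; rewrite !inE uA orbT.
have [g2 [g2nat g2M g2E]] := fill_horn Sd (Full_chain fU) (setU11 _ _) (UA _ aA)
  (UA _ bA) av bv lav lvb Sface nSU HM g1nat g1M.
have [||||||g3 [g3nat g3M g3E]] := IH (fun B => S B || (B \subset v A |: A)) g2.
- rewrite -ltnS; apply: leq_trans cardS; rewrite ltnS; apply: proper_card.
  apply/properP; split.
    by apply/subsetP => B; rewrite !inE negb_or => /and3P [-> ->].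
  by exists A; rewrite !inE ?fA ?nSA // subsetU1 orbT.
- by move=> B /S0S ->.
- move=> B B' BB' /orP [/(Sd _ _ BB') -> // | /(subset_trans BB') ->].
  by rewrite orbT.
- move=> B fB nS0B; case: (boolP (S B)) => [SB _ | nSB /= sub].
    by rewrite Sv.
  by have [-> ->] := new _ sub nSB; rewrite subxx orbT.
- exact: g2nat.
- exact: g2M.
by exists g3; split=> // n s Ss; rewrite g3E ?Ss // g2E.
Qed.
End Matching.
End Complexes.

(* [eps = true] gives the nerves of the L case, [eps = false] those of the R case;
   the set-level combinatorics of chains does not see the direction. *)
Definition dir T (eps : bool) (r : rel T) : rel T :=
  fun x y => if eps then r x y else r y x.

Lemma chain_dir (Q : finType) eps (r : rel Q) (A : {set Q}) :
  chain (dir eps r) A = chain r A.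
Proof.
case: eps => //; apply/chainP/chainP => H x y xA yA; rewrite orbC; exact: H.
Qed.

Lemma dir_refl T eps (r : rel T) : reflexive r -> reflexive (dir eps r).
Proof. by case: eps => H x; apply: H. Qed.

Lemma dir_anti T eps (r : rel T) : antisymmetric r -> antisymmetric (dir eps r).
Proof. by case: eps => H x y; rewrite /dir; [apply: H | rewrite andbC; apply: H]. Qed.

Lemma dir_trans T eps (r : rel T) : transitive r -> transitive (dir eps r).
Proof.
by case: eps => H x y z; rewrite /dir; [apply: H | move=> xy xz; exact: H xy].
Qed.

(** * Chains in the cylinder over a poset with greatest element *)

Section Cone.
Variables (P : finType) (le : rel P) (t : P).
Hypotheses (le_refl : reflexive le) (le_anti : antisymmetric le)
  (le_trans : transitive le) (le_top : forall x, le x t).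

Local Notation Q := (P * bool)%type.

Definition cyl_le : rel Q := fun x y => le x.1 y.1 && (x.2 ==> y.2).

Lemma cyl_refl : reflexive cyl_le.
Proof. by move=> x; rewrite /cyl_le le_refl implybb. Qed.

Lemma cyl_anti : antisymmetric cyl_le.
Proof.
move=> [x i] [y j]; rewrite /cyl_le /= => /andP [/andP [xy ij] /andP [yx ji]].
by rewrite (le_anti (introT andP (conj xy yx))); case: i j ij ji => -[].
Qed.

Lemma cyl_trans : transitive cyl_le.
Proof.
move=> [y j] [x i] [z l] /andP [/= xy ij] /andP [/= yz jl].
by rewrite /cyl_le /= (le_trans xy yz); case: i j l ij jl => -[] [].
Qed.

Definition cyl_full (A : {set Q}) : bool := chain cyl_le A && ((t, false) \notin A).

Definition cyl_base (A : {set Q}) : bool :=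
  cyl_full A && (((t, true) \notin A) || [forall x in A, x.2]).

Definition is_peak (A : {set Q}) (p : P) : bool :=
  ((p, false) \in A) && [forall q, ((q, false) \in A) ==> le q p].

(** The default [t] is never reached on a missing chain, by [peak_exists]. *)
Definition peak (A : {set Q}) : Q := (odflt t [pick p | is_peak A p], true).

(** Lower-level vertices count twice, so that trading [(p, false)] for [(p, true)] lowers the rank,
    as does removing any vertex. *)
Definition cyl_rank (A : {set Q}) : nat := #|A| + #|[set x in A | ~~ x.2]|.

Lemma cyl_full_down : down_closed cyl_full.
Proof.
move=> A B AB /andP [cB tB]; rewrite /cyl_full (chainS AB) //=.
by apply: contra tB; apply: (subsetP AB).
Qed.

Lemma cyl_base_down : down_closed cyl_base.
Proof.
move=> A B AB /andP [fB dB]; rewrite /cyl_base (cyl_full_down AB fB) /=.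
case/orP: dB => [tB | /forall_inP B1]; apply/orP; [left | right].
  by apply: contra tB; apply: (subsetP AB).
by apply/forall_inP => x xA; apply: B1; apply: (subsetP AB).
Qed.

Lemma cyl_rank_proper (A B : {set Q}) : A \proper B -> cyl_rank A < cyl_rank B.
Proof.
move=> AB; rewrite /cyl_rank -addSn; apply: leq_add; first exact: proper_card.
by apply/subset_leq_card/subsetP => x; rewrite !inE => /andP [/(subsetP (proper_sub AB)) -> ->].
Qed.

Lemma is_peakP (A : {set Q}) p : reflect
  ((p, false) \in A /\ forall q, (q, false) \in A -> le q p) (is_peak A p).
Proof.
apply: (iffP andP) => -[pA H]; split=> //.
  by move=> q qA; apply: (implyP (forallP H q)).
by apply/forallP => q; apply/implyP; apply: H.
Qed.

Lemma peakE (A : {set Q}) p : is_peak A p -> peak A = (p, true).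
Proof.
move=> /is_peakP [pA pmax]; rewrite /peak; case: pickP => [q /is_peakP [qA qmax] | /(_ p)].
  by congr pair; apply: le_anti; rewrite /= pmax // qmax.
by case/negP; apply/is_peakP.
Qed.

(** A missing chain contains [(t, true)] and meets the lower level. Its lower vertex with the most
    elements of [P] below it is the largest one, and differs from [t] because [(t, false)] is
    excluded. *)
Lemma peak_exists (A : {set Q}) : cyl_full A -> ~~ cyl_base A ->
  (t, true) \in A /\ exists2 p, is_peak A p & p != t.
Proof.
move=> fA; rewrite /cyl_base fA negb_or negbK => /andP [tA].
rewrite negb_forall => /existsP [[p0 i]]; rewrite negb_imply /=.
case: i => /andP [pA] // _; split=> //.
case/andP: fA => /chainP cA tfA.
pose down p := #|[pred q | le q p]|.
case: (@arg_maxnP _ p0 (fun p => (p, false) \in A) down pA) => p pA' pmax.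
exists p; last by apply: contraNneq tfA => <-.
apply/is_peakP; split=> // q qA.
have := cA _ _ pA' qA; rewrite /cyl_le /= !andbT => /orP [pq | //].
have sub : [pred r | le r p] \subset [pred r | le r q].
  by apply/subsetP => r; rewrite !inE => rp; apply: le_trans pq.
have /subset_cardP/(_ sub)/(_ q) : #|[pred r | le r p]| = #|[pred r | le r q]|.
  by apply/eqP; rewrite eqn_leq subset_leq_card //; apply: (pmax q qA).
by rewrite !inE le_refl.
Qed.

Lemma peak_setU (A : {set Q}) p : is_peak A p -> is_peak ((p, true) |: A) p.
Proof.
move=> /is_peakP [pA pm]; apply/is_peakP; split; first by rewrite !inE pA orbT.
by move=> q; rewrite !inE => /orP [/eqP [] // |]; apply: pm.
Qed.

Lemma peak_setD (A : {set Q}) p u : is_peak A p -> u != (p, false) -> is_peak (A :\ u) p.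
Proof.
move=> /is_peakP [pA pm] up; apply/is_peakP; split; first by rewrite !inE pA eq_sym up.
by move=> q; rewrite !inE => /andP [_]; apply: pm.
Qed.

Lemma peak_not_base (A : {set Q}) p : is_peak A p -> (t, true) \in A -> ~~ cyl_base A.
Proof.
move=> /is_peakP [pA _] tA; rewrite /cyl_base tA /=; apply/negP => /andP [_].
by move/forall_inP/(_ _ pA).
Qed.

(** Lower vertices of [A] lie under [p]. An upper vertex is comparable to [(p, false)] but never
    below it, so it lies above [(p, true)]. *)
Lemma cyl_full_peak (A : {set Q}) p : cyl_full A -> is_peak A p -> p != t ->
  cyl_full ((p, true) |: A).
Proof.
move=> /andP [/chainP cA tA] /is_peakP [pA pm] pt; apply/andP; split; last first.
  by rewrite in_setU1 negb_or tA xpair_eqE andbF.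
have cmp x : x \in A -> cyl_le x (p, true) || cyl_le (p, true) x.
  case: x => q [] qA; rewrite /cyl_le /= ?implybT ?andbT.
    have := cA _ _ pA qA; rewrite /cyl_le /= andbT andbF orbF => ->.
    by rewrite orbT.
  by rewrite (pm q qA).
apply/chainP => x y; rewrite !inE => /orP [/eqP -> | xA] /orP [/eqP -> | yA].
- by rewrite cyl_refl.
- by rewrite orbC cmp.
- exact: cmp.
- exact: cA.
Qed.

Variable eps : bool.

Variables (C : sSet) (W : C 1 -> Prop).
Hypotheses (qC : quasicategory C) (wW : weakly_closed W).
Variable mk : rel P.
Hypothesis mk_refl : reflexive mk.

Local Notation X := (nerve (dir eps le)).
Local Notation N := (nerve (dir eps cyl_le)).
Local Notation M := (fun x y : Q => mk x.1 y.1).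

(** The vertices [(p, false)] and [(t, true)] flank the peak, so every horn filled is inner;
    reversing the order through [eps] only exchanges the two. *)
Lemma extend_cylinder (g : forall n, N n -> C n) :
  nat_on cyl_base g -> marks W M cyl_base g ->
  exists g' : forall n, N n -> C n,
    [/\ nat_on cyl_full g', marks W M cyl_full g' &
        forall n (s : N n), cyl_base (im s) -> g' n s = g n s].
Proof.
apply: (@extend_matching _ _ (dir_refl eps cyl_refl) (dir_anti (eps:=eps) cyl_anti)
  (dir_trans (eps:=eps) cyl_trans) C W qC wW M (fun x => mk_refl x.1)
  cyl_full cyl_base peak cyl_rank).
- by move=> A /andP [cA _]; rewrite chain_dir.
- exact: cyl_full_down.
- exact: cyl_base_down.
- exact: cyl_rank_proper.
- move=> A fA nb; have [tA [p pA pt]] := peak_exists fA nb.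
  by rewrite (peakE pA); apply: cyl_full_peak.
- move=> A fA nb; have [tA [p pA pt]] := peak_exists fA nb.
  rewrite (peakE pA); have [pfA _] := is_peakP _ _ pA.
  have tp : (t, true) != (p, true) by apply: contraNneq pt => -[->].
  have l1 : cyl_le (p, false) (p, true) by rewrite /cyl_le le_refl.
  have l2 : cyl_le (p, true) (t, true) by rewrite /cyl_le le_top.
  rewrite /dir; case: (eps); [exists (p, false), (t, true) | exists (t, true), (p, false)];
    by split=> //; rewrite ?l1 ?l2 ?xpair_eqE ?andbF.
- move=> A fA nb; have [tA [p pA pt]] := peak_exists fA nb.
  by rewrite (peakE pA); apply: peakE; apply: peak_setU.
- move=> A fA nb; have [tA [p pA pt]] := peak_exists fA nb.
  have pD : is_peak (A :\ (p, true)) p by apply: peak_setD => //; rewrite xpair_eqE andbF.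
  rewrite (peakE pA) (peakE pD); split=> //; apply: peak_not_base pD _.
  by rewrite !inE tA andbT; apply: contraNneq pt => -[->].
- move=> A u fA nb; have [tA [p pA pt]] := peak_exists fA nb.
  rewrite (peakE pA) => vA uA; have [pfA _] := is_peakP _ _ pA.
  have [-> | up] := eqVneq u (p, false).
    apply: Or33; rewrite /cyl_rank cardsU1 !inE (negbTE vA) andbF /= add1n.
    rewrite [#|A|](cardsD1 (p, false)) pfA add1n -addnS leq_add2l.
    have -> : [set x in (p, true) |: A :\ (p, false) | ~~ x.2]
              = [set x in A | ~~ x.2] :\ (p, false).
      by apply/setP => -[q []]; rewrite !inE !xpair_eqE /= ?andbF ?andbT.
    by rewrite [X in _ < X](cardsD1 (p, false)) !inE pfA.
  (* Deleting [(t, true)] lands in the base; deleting any other vertex still in play leaves the peak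
     unchanged. *)
  have [-> | ut] := eqVneq u (t, true).
    apply: Or31; apply/andP; split.
      apply: cyl_full_down (cyl_full_peak fA pA pt).
      by apply: setUS; apply: subD1set.
    rewrite !inE eqxx orbF; apply/orP; left.
    by apply: contraNneq pt => -[->].
  have pD := peak_setD pA up.
  apply: Or32; split; last exact: peakE.
  by apply: peak_not_base pD _; rewrite !inE tA eq_sym ut.
(* [M] only reads the coordinate in [P], which the peak shares with the end [(p, false)]. One half
   is marked by reflexivity, the other because the given edge is. *)
- move=> x y lxy fA nb; have [tA [p pA pt]] := peak_exists fA nb.
  rewrite (peakE pA) /=; have [/set2P pfA _] := is_peakP _ _ pA.
  by case: pfA => <- /= Mxy; rewrite mk_refl.
Qed.


(** * Gluing the lift and the homotopy over the cylinder *)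

Variables (Pr : forall n, X n -> bool)
  (HPr : forall m n (f : monmap m n) (x : X n), Pr x -> Pr (sact f x)).
Hypothesis PrE : forall n (x : X n), Pr x = [forall i, sval x i != t].

(** The upper level is the end of the homotopy carrying [F]: vertex 1 in the L case, vertex 0 in the
    R case. *)
Definition level (b : bool) : 'I_2 := if b == eps then ord_max else ord0.

Lemma proj_base_chain n (s : N n) : chainb (dir eps le) [ffun i => (sval s i).1].
Proof.
apply/forallP => i; apply/forallP => j; apply/implyP => ij; rewrite !ffunE.
by move: (nerve_le s ij); move: (sval s i) (sval s j) => x y; rewrite /dir; case: (eps) => /andP [].
Qed.
Definition proj_base n (s : N n) : X n :=
  exist (@chainb _ (dir eps le) n) _ (proj_base_chain s).

Lemma proj_level_chain n (s : N n) :
  chainb (fun i j : 'I_2 => i <= j) [ffun i => level (sval s i).2].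
Proof.
apply/forallP => i; apply/forallP => j; apply/implyP => ij; rewrite !ffunE.
move: (nerve_le s ij); move: (sval s i) (sval s j) => [x bx] [y by_].
by rewrite /level /dir; case: (eps) => /andP [_] /=; case: bx; case: by_.
Qed.
Definition proj_level n (s : N n) : Delta 1 n :=
  exist (@chainb _ (fun i j : 'I_2 => i <= j) n) _ (proj_level_chain s).

Lemma proj_base_act m n (f : monmap m n) (s : N n) :
  proj_base (sact f s) = sact f (proj_base s).
Proof. by apply: sig_bool_eq; apply/ffunP => i; rewrite /= !ffunE. Qed.

Lemma proj_level_act m n (f : monmap m n) (s : N n) :
  proj_level (sact f s) = sact f (proj_level s).
Proof. by apply: sig_bool_eq; apply/ffunP => i; rewrite /= !ffunE. Qed.

Lemma proj_level_cst n (s : N n) b :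
  (forall i, (sval s i).2 = b) -> proj_level s = cst n (level b).
Proof. by move=> H; apply: sig_bool_eq; apply/ffunP => i; rewrite /= !ffunE H. Qed.

(** The poset sits in the lower level with only [t] raised; order is preserved because nothing but
    [t] lies above [t]. *)
Lemma cone_vertex_chain n (s : X n) :
  chainb (dir eps cyl_le) [ffun i => (sval s i, sval s i == t)].
Proof.
have top_le p q : le p q -> cyl_le (p, p == t) (q, q == t).
  move=> pq; rewrite /cyl_le /= pq /=; apply/implyP => /eqP pt; apply/eqP.
  by apply: le_anti; rewrite le_top -pt pq.
apply/forallP => i; apply/forallP => j; apply/implyP => ij; rewrite !ffunE.
by move: (nerve_le s ij); move: (sval s i) (sval s j) => x y; rewrite /dir; case: (eps) => /top_le.
Qed.
Definition cone_incl n (s : X n) : N n :=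
  exist (@chainb _ (dir eps cyl_le) n) _ (cone_vertex_chain s).

Lemma cone_incl_act m n (f : monmap m n) (s : X n) :
  cone_incl (sact f s) = sact f (cone_incl s).
Proof. by apply: sig_bool_eq; apply/ffunP => i; rewrite /= !ffunE. Qed.

Lemma cone_inclK n (s : X n) : proj_base (cone_incl s) = s.
Proof. by apply: sig_bool_eq; apply/ffunP => i; rewrite /= !ffunE. Qed.

Lemma cone_incl_full n (s : X n) : cyl_full (im (cone_incl s)).
Proof.
rewrite /cyl_full -(chain_dir eps) im_chain; apply/imsetP => -[i _].
by rewrite /= ffunE => -[<-]; rewrite eqxx.
Qed.

Variables (hW : degen_marked W) (alpha : mMap (mprod (MSSet hW) Delta1s) (MSSet hW)).
Variables (h : sMap (subsSet HPr) C) (G : sMap X C).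
Hypothesis alpha0 : forall n (x : C n), alpha n (x, cst n (level false)) = x.
Hypothesis alpha1 : forall n (j : subsSet HPr n),
  alpha n (h n j, cst n (level true)) = G n (sval j).
Hypothesis hmk : forall e : subsSet HPr 1,
  mk (sval (sval e) ord0) (sval (sval e) ord_max) -> W (h 1 e).
Hypothesis Gmk : forall e : X 1, mk (sval e ord0) (sval e ord_max) -> W (G 1 e).

(** [insub] tests whether the projection avoids [t]. Outside [cyl_base] the value of [G] is an
    arbitrary default. *)
Definition glue n (s : N n) : C n :=
  if insub (proj_base s) is Some j then alpha n (h n j, proj_level s)
  else G n (proj_base s).

Lemma glue_avoid n (s : N n) (Ps : Pr (proj_base s)) :
  glue s = alpha n (h n (exist (@Pr n) _ Ps), proj_level s).
Proof. by rewrite /glue insubT. Qed.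

(** On an upper chain avoiding [t] both formulas apply, and [alpha1] makes them agree: the upper end
    of the homotopy on [h] is what [G] extends. *)
Lemma glue_upper n (s : N n) : (forall i, (sval s i).2) -> glue s = G n (proj_base s).
Proof.
move=> s1; case: (boolP (Pr (proj_base s))) => Ps; last by rewrite /glue insubN.
by rewrite glue_avoid (@proj_level_cst _ _ true) // alpha1.
Qed.

Lemma cyl_base_cases n (s : N n) :
  cyl_base (im s) -> Pr (proj_base s) \/ forall i, (sval s i).2.
Proof.
case/andP => /andP [_ tf] /orP [tt | /forall_inP H]; last first.
  by right=> i; apply: H; apply: mem_im.
left; rewrite PrE; apply/forallP => i; rewrite /= ffunE; apply/eqP => E.
have := mem_im s i; rewrite [sval s i]surjective_pairing E.
by case: (_.2) => H; [rewrite H in tt | rewrite H in tf].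
Qed.

Lemma glue_nat : nat_on cyl_base glue.
Proof.
move=> m n f s /cyl_base_cases [Ps | s1].
  have Pfs : Pr (proj_base (sact f s)) by rewrite proj_base_act; apply: HPr.
  rewrite (glue_avoid Ps) (glue_avoid Pfs) -smap_nat; congr (alpha m _).
  rewrite proj_level_act; congr pair; rewrite -smap_nat; congr (h m _).
  by apply: sig_bool_eq; rewrite /= proj_base_act.
rewrite !glue_upper //; last by move=> i; rewrite /= ffunE.
by rewrite proj_base_act smap_nat.
Qed.

Lemma glue_marks : marks W M cyl_base glue.
Proof.
move=> e /cyl_base_cases [Pe | e1] Me.
  rewrite (glue_avoid Pe); apply: (@mmap_marked _ _ alpha).
  (* Every edge of [Delta1s] is marked, so only the component in [C] has to be checked. *)
  by split=> //=; apply: hmk; rewrite /= !ffunE.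
by rewrite glue_upper //; apply: Gmk; rewrite /= !ffunE.
Qed.

(** The extension over the cylinder is restricted along [cone_incl]. A simplex avoiding [t] stays in
    the lower level, where the homotopy is the identity, so the restriction extends [h]. *)
Lemma extend_cone : exists g : sMap X C,
  (forall n (j : subsSet HPr n), g n (sval j) = h n j) /\
  (forall e : X 1, mk (sval e ord0) (sval e ord_max) -> W (g 1 e)).
Proof.
have [g [gnat gM gE]] := extend_cylinder glue_nat glue_marks.
have nat m n (f : monmap m n) (s : X n) :
    g m (cone_incl (sact f s)) = sact f (g n (cone_incl s)).
  by rewrite cone_incl_act gnat // cone_incl_full.
exists (@SMap X C (fun n s => g n (cone_incl s)) nat); split=> [n j | e Me] /=.
  have Pj := svalP j; have jt i : sval (sval j) i != t.
    by move: Pj; rewrite PrE => /forallP.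
  rewrite gE; last first.
    rewrite /cyl_base cone_incl_full; apply/orP; left; apply/imsetP => -[i _].
    by rewrite /= ffunE => -[E _]; have := jt i; rewrite -E eqxx.
  have Pj' : Pr (proj_base (cone_incl (sval j))) by rewrite cone_inclK.
  rewrite (glue_avoid Pj') (@proj_level_cst _ _ false); last first.
    by move=> i; rewrite /= ffunE /=; apply/negbTE.
  by rewrite alpha0; congr (h n _); apply: sig_bool_eq; rewrite /= cone_inclK.
by apply: gM; [apply: cone_incl_full | rewrite /= !ffunE].
Qed.
End Cone.

(** * The subset posets and the two lifting statements *)

Section Lel.
Variables (n : nat) (k : 'I_n.+1).

Definition Ltop : Lel k := exist (fun A : {set 'I_n.+1} => k \in A) _ (in_setT k).

Lemma Lle_refl : reflexive (@Lle n k).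
Proof. by move=> A; apply: subxx. Qed.

Lemma Lle_anti : antisymmetric (@Lle n k).
Proof. by move=> A B H; apply: sig_bool_eq; apply/eqP; rewrite eqEsubset. Qed.

Lemma Lle_trans : transitive (@Lle n k).
Proof. by move=> A B D; apply: subset_trans. Qed.

Lemma Lle_top A : Lle A Ltop.
Proof. exact: subsetT. Qed.

Lemma omitTopPE m (s : {ffun 'I_m.+1 -> Lel k}) :
  omitTopP s = [forall i, s i != Ltop].
Proof.
by apply: eq_forallb => i; congr negb; apply/eqP/eqP => [/sig_bool_eq | ->].
Qed.
End Lel.

Theorem theorem6p10 (C : sSet) (W W0 : C 1 -> Prop)
  (hW : degen_marked W) (hW0 : degen_marked W0)
  (F : mMap (MSSet hW) (MSSet hW0)) :
  quasicategory C ->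
  (forall e, W0 e -> W e) ->
  weakly_closed W ->
  ((forall n (k : 'I_n.+1), 2 <= n -> 0 < k -> mRLP (LJ_incl k) (MSSet hW0)) ->
   (exists alpha : mMap (mprod (MSSet hW) Delta1s) (MSSet hW),
       @mhomotopy (MSSet hW) (MSSet hW) (fun n x => x) (fun n x => F n x) alpha) ->
   CLF (MSSet hW))
  /\
  ((forall n (k : 'I_n.+1), 2 <= n -> k < n -> mRLP (RJ_incl k) (MSSet hW0)) ->
   (exists alpha : mMap (mprod (MSSet hW) Delta1s) (MSSet hW),
       @mhomotopy (MSSet hW) (MSSet hW) (fun n x => F n x) (fun n x => x) alpha) ->
   CRF (MSSet hW)).
Proof.
move=> qC W0W wW; split=> lift [alpha Halpha]; split=> // n k n2 hk h.
- have Fnat m p (f : monmap m p) (x : LJ k p) :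
    F m (h m (sact f x)) = sact f (F p (h p x)) by rewrite !smap_nat.
  (* Since [F] carries [W] into [W0], the composite is a marked map to which the lifting hypothesis
     applies. *)
  pose Fh : mMap (LJ k) (MSSet hW0) := @MMap (LJ k) (MSSet hW0)
    (@SMap (LJ k) C (fun m x => F m (h m x)) Fnat)
    (fun e me => mmap_marked F (mmap_marked h me)).
  have [G GE] := lift n k n2 hk Fh.
  have [||||g [gE gM]] := @extend_cone _ _ (Ltop k) (@Lle_refl n k) (@Lle_anti n k)
    (@Lle_trans n k) (@Lle_top n k) true C W qC wW
    (fun A B => maxs (sval A) == maxs (sval B)) (fun _ => eqxx _)
    (@LJP n k) (@omitTopL_act n k) (fun m x => omitTopPE (sval x)) hW alpha h G.
  + by move=> m x; have [] := Halpha m x.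
  + by move=> m j; have [_ ->] := Halpha m (h m j); apply: (esym (GE m j)).
  + by move=> e /eqP me; apply: (mmap_marked h).
  + by move=> e /eqP me; apply: W0W; apply: (mmap_marked G).
  by exists (@MMap (L k) (MSSet hW) g (fun e me => gM e (introT eqP me))) => m a; apply: gE.
- have Fnat m p (f : monmap m p) (x : RJ k p) :
    F m (h m (sact f x)) = sact f (F p (h p x)) by rewrite !smap_nat.
  pose Fh : mMap (RJ k) (MSSet hW0) := @MMap (RJ k) (MSSet hW0)
    (@SMap (RJ k) C (fun m x => F m (h m x)) Fnat)
    (fun e me => mmap_marked F (mmap_marked h me)).
  have [G GE] := lift n k n2 hk Fh.
  (* With [eps = false] the arrows are reversed, so the upper level is the start of the homotopy,
     which is again [F]. *)
  have [||||g [gE gM]] := @extend_cone _ _ (Ltop k) (@Lle_refl n k) (@Lle_anti n k)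
    (@Lle_trans n k) (@Lle_top n k) false C W qC wW
    (fun A B => mins (sval A) == mins (sval B)) (fun _ => eqxx _)
    (@RJP n k) (@omitTopR_act n k) (fun m x => omitTopPE (sval x)) hW alpha h G.
  + by move=> m x; have [] := Halpha m x.
  + by move=> m j; have [-> _] := Halpha m (h m j); apply: (esym (GE m j)).
  + by move=> e /eqP me; apply: (mmap_marked h).
  + by move=> e /eqP me; apply: W0W; apply: (mmap_marked G).
  by exists (@MMap (R k) (MSSet hW) g (fun e me => gM e (introT eqP me))) => m a; apply: gE.
Qed.
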